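(* Let $1\le p<\infty$ and let $w$ be a quasi-concave function on $[0,1]$ with $w(1)=1$. The Rademacher functions span $l_2$ in the Morrey space $M_{p,w}$ if and only if $$\sup_{0<t\le 1} w(t)\,\big(\log_2(2/t)\big)^{1/2}<\infty .$$
   Context: A function $w:[0,1]\to[0,\infty)$ is quasi-concave if $w(0)=0$, $w$ is non-decreasing, and $w(t)/t$ is non-increasing on $(0,1]$. The Morrey space $M_{p,w}$ is the Banach space of all (a.e. classes of) measurable $f:[0,1]\to\mathbb R$ with $$\|f\|_{M_{p,w}}=\sup_I w(|I|)\Big(\frac1{|I|}\int_I|f(t)|^p\,dt\Big)^{1/p}<\infty,$$ the supremum being over all (non-degenerate) intervals $I\subset[0,1]$, where $|I|$ is the Lebesgue measure of $I$. The Rademacher functions are $r_k(t)=\mathrm{sign}(\sin 2^k\pi t)$, $k\in\mathbb N=\{1,2,\dots\}$, $t\in[0,1]$. ''The Rademacher functions span $l_2$ in $M_{p,w}$'' means that $\{r_k\}$ is equivalent in $M_{p,w}$ to the unit vector basis of $l_2$: there is $C\ge1$ such that $C^{-1}(\sum_{k=1}^n a_k^2)^{1/2}\le\|\sum_{k=1}^n a_k r_k\|_{M_{p,w}}\le C(\sum_{k=1}^n a_k^2)^{1/2}$ for all $n\in\mathbb N$ and all real $a_1,\dots,a_n$. *)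

(* Defs.v *)
From HB Require Import structures.
From mathcomp Require Import all_boot all_order all_algebra.
From mathcomp Require Import all_classical all_reals all_analysis.

Set Implicit Arguments.
Unset Strict Implicit.
Unset Printing Implicit Defensive.

Import Order.TTheory GRing.Theory Num.Theory.
Import numFieldNormedType.Exports.

Local Open Scope classical_set_scope.
Local Open Scope ring_scope.

(** Functions on [0, 1] are represented by total functions [R -> R]; only their
    values on [0, 1] matter below. *)

Definition quasi_concave (R : realType) (w : R -> R) : Prop :=
  [/\ w 0 = 0,
      forall t, 0 <= t <= 1 -> 0 <= w t,
      forall s t, 0 <= s -> s <= t -> t <= 1 -> w s <= w t &
      forall s t, 0 < s -> s <= t -> t <= 1 -> w t / t <= w s / s].

Definition nondegenerate_subitv01 (R : realType) (I : interval R) : Prop :=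
  [set` I] `<=` `[0, 1] /\ (0 < @lebesgue_measure R [set` I])%E.

Definition itv_length (R : realType) (I : interval R) : R :=
  fine (@lebesgue_measure R [set` I]).

(** Extended-real valued, so that it makes sense for every measurable [f]. *)
Definition morrey_norm (R : realType) (p : R) (w f : R -> R) : \bar R :=
  ereal_sup
    [set ((w (itv_length I))%:E *
          (((itv_length I)^-1)%:E *
           \int[@lebesgue_measure R]_(t in [set` I]) (`|f t| `^ p)%:E)
            `^ p^-1)%E
    | I in @nondegenerate_subitv01 R].

(** Elements are given by Borel measurable representatives (every Lebesgue
    measurable function is almost everywhere equal to one); [morrey_norm] does
    not depend on the representative. *)
Definition morrey_space (R : realType) (p : R) (w : R -> R) : set (R -> R) :=
  [set f : R -> R | measurable_fun (`[0, 1] : set R) f /\ (morrey_norm p w f < +oo)%E].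

Definition rademacher (R : realType) (k : nat) (t : R) : R :=
  Num.sg (sin (2 ^+ k * pi * t)).

(** The sequence is [x 1, x 2, ...]; the value [x 0] is not used. *)
Definition equivalent_to_l2_basis (R : realType) (p : R) (w : R -> R)
    (x : nat -> R -> R) : Prop :=
  (forall k, (0 < k)%N -> morrey_space p w (x k)) /\
  exists2 C : R, 1 <= C &
    forall (n : nat) (a : nat -> R), (0 < n)%N ->
      let l2 := Num.sqrt (\sum_(1 <= k < n.+1) a k ^+ 2) in
      let N := morrey_norm p w (fun t => \sum_(1 <= k < n.+1) a k * x k t) in
      ((C^-1 * l2)%:E <= N)%E /\ (N <= (C * l2)%:E)%E.

Definition rademacher_span_l2 (R : realType) (p : R) (w : R -> R) : Prop :=
  equivalent_to_l2_basis p w (@rademacher R).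

Definition log2 (R : realType) (x : R) : R := ln x / ln 2.

(* Main.v *)
Require Import Defs.
From mathcomp Require Import all_boot all_order all_algebra.
From mathcomp Require Import all_classical all_reals all_analysis.
From mathcomp Require Import measurable_realfun.
From mathcomp Require Import ring lra zify.

Set Implicit Arguments.
Unset Strict Implicit.
Unset Printing Implicit Defensive.

Import Order.TTheory GRing.Theory Num.Theory.
Import numFieldNormedType.Exports.

Local Open Scope classical_set_scope.
Local Open Scope ring_scope.

(** Averaging over a dyadic interval of length [2^-m] freezes [r_1, ..., r_m]
    and leaves [r_(m+1), r_(m+2), ...] behaving as independent fair signs.
    Hence the mean of [|a_1 r_1 + ... + a_n r_n|^p] over such an interval is the
    average of [|c + e_(m+1) a_(m+1) + ... + e_n a_n|^p] over all signs [e_k],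
    where [c] is the frozen head ([integral_powR_dyadic]).  Everything then
    becomes an estimate of finite averages of Khintchine type.  Write [l2] for
    the square root of [a_1^2 + ... + a_n^2].

    The lower bound of the norm comes from the interval [[0, 1]], where [w] is
    [1]: the [p]-mean over it is at least a multiple of [l2], by the
    Paley-Zygmund argument with second and fourth moments
    ([sign_mean_powR_ge], [morrey_norm_ge]).

    For the upper bound, take [I] with [2^-(m+1) < |I| <= 2^-m] and cover it by
    two dyadic intervals of length [2^-m].  On each, the frozen head is at most
    [sqrt m * l2] by Cauchy-Schwarz, and the free tail has [p]-th moment at most
    a constant times [l2^p] by exponential moments ([sign_mean_powR_le]).  So
    the [p]-mean over [I] is [O(sqrt (m + 1) * l2)], and [sqrt (m + 1)] is at
    most [sqrt (log2 (2 / |I|))], which [w |I|] compensates by assumption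
    ([morrey_norm_le]).

    Conversely, [r_1 + ... + r_n = n] on [(0, 2^-n)], so that interval gives
    norm at least [w (2^-n) * n], while [l2 = sqrt n].  If the functions span
    [l_2], then [w (2^-n) * sqrt n] is bounded, and the monotonicity of [w]
    carries this bound from the points [2^-n] to all of [(0, 1]]. *)

(** * Averages over random signs *)

Section SignMean.
Variable R : realType.
Implicit Types (a : nat -> R) (f g : R -> R) (c t s p : R) (m d : nat).

(** The expectation of [f (c + e_(m+1) a_(m+1) + ... + e_(m+d) a_(m+d))] for
    independent fair signs [e_k].  One step of the recursion fixes the sign that
    is decided when a dyadic interval of level [m] is halved, so the integrals
    of Rademacher sums obey the same recursion. *)
Fixpoint sign_mean a f m d c : R :=
  if d is d'.+1 then
    (sign_mean a f m.+1 d' (c + a m.+1) + sign_mean a f m.+1 d' (c - a m.+1))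
      / 2
  else f c.

Definition sq_sum a m d : R := \sum_(m.+1 <= k < (m + d).+1) a k ^+ 2.

Lemma sq_sum_recl a m d : sq_sum a m d.+1 = a m.+1 ^+ 2 + sq_sum a m.+1 d.
Proof.
by rewrite /sq_sum big_ltn ?ltnS ?addnS ?leq_addr// addSn.
Qed.

Lemma sq_sum_ge0 a m d : 0 <= sq_sum a m d.
Proof. by apply: sumr_ge0 => k _; exact: sqr_ge0. Qed.

Lemma le_sign_mean a f g m d c :
  (forall x, f x <= g x) -> sign_mean a f m d c <= sign_mean a g m d c.
Proof.
move=> fg; elim: d m c => [|d IH] m c //=.
by have := IH m.+1 (c + a m.+1); have := IH m.+1 (c - a m.+1); lra.
Qed.

Lemma sign_mean_comb a f g k l m d c :
  sign_mean a (fun x => k * f x + l * g x) m d c =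
  k * sign_mean a f m d c + l * sign_mean a g m d c.
Proof. by elim: d m c => [|d IH] m c //=; rewrite !IH; field. Qed.

Lemma sign_mean_cst a k m d c : sign_mean a (cst k) m d c = k.
Proof. by elim: d m c => [|d IH] m c //=; rewrite !IH; field. Qed.

Lemma sign_mean_sqr a m d c :
  sign_mean a (fun x => x ^+ 2) m d c = c ^+ 2 + sq_sum a m d.
Proof.
elim: d m c => [|d IH] m c /=; first by rewrite /sq_sum addn0 big_geq ?addr0.
by rewrite !IH sq_sum_recl; field.
Qed.

Lemma sign_mean_pow4 a m d c :
  sign_mean a (fun x => x ^+ 4) m d c <=
  c ^+ 4 + 6 * c ^+ 2 * sq_sum a m d + 3 * sq_sum a m d ^+ 2.
Proof.
elim: d m c => [|d IH] m c /=.
  by rewrite /sq_sum addn0 big_geq // expr0n/= !mulr0 !addr0.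
have := IH m.+1 (c + a m.+1); have := IH m.+1 (c - a m.+1).
rewrite sq_sum_recl; move: (a m.+1) (sq_sum _ _ _) => b S.
have : 0 <= b ^+ 4 by rewrite (exprM b 2 2) sqr_ge0.
lra.
Qed.

(** For [t >= 1/2] both exponents on the left are at most [t <= 2 t^2]; for
    smaller [t], [exp u >= 1 + u] at [u = t] and [u = - t] gives
    [2 cosh t <= 1 / (1 - t) + 1 / (1 + t) = 2 / (1 - t^2)], which is at most
    [2 (1 + 2 t^2)]. *)
Lemma cosh_le_expR t : expR t + expR (- t) <= 2 * expR (2 * t ^+ 2).
Proof.
wlog t0 : t / 0 <= t.
  move=> H; have [/H//|t0] := leP 0 t.
  by have := H (- t); rewrite opprK sqrrN addrC; apply; rewrite oppr_ge0 ltW.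
have [t2|t2] := leP t 2^-1; last first.
  have h1 : expR t <= expR (2 * t ^+ 2) by rewrite ler_expR; nra.
  have h2 : expR (- t) <= expR (2 * t ^+ 2) by rewrite ler_expR; nra.
  lra.
have := expR_ge1Dx (2 * t ^+ 2).
have := expR_ge1Dx t; have := expR_ge1Dx (- t).
have := expRxMexpNx_1 t; have := expR_gt0 t; have := expR_gt0 (- t).
move: (expR t) (expR (- t)) (expR (2 * _)) => u v e v0 u0 uv h1 h2 h3.
have h4 : u * (1 - t) <= 1.
  have : 0 <= u * (v - (1 - t)) by rewrite mulr_ge0 ?(ltW u0, ltW v0)//; lra.
  by rewrite mulrBr uv subr_ge0.
have h5 : v * (1 + t) <= 1.
  have : 0 <= v * (u - (1 + t)) by rewrite mulr_ge0 ?(ltW u0, ltW v0)//; lra.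
  by rewrite mulrBr [v * u]mulrC uv subr_ge0.
have h6 : (u + v) * (1 - t ^+ 2) <= 2.
  have : u * (1 - t) * (1 + t) <= 1 * (1 + t) by rewrite ler_wpM2r//; lra.
  have : v * (1 + t) * (1 - t) <= 1 * (1 - t) by rewrite ler_wpM2r//; lra.
  lra.
have t4 : t ^+ 2 <= 4^-1 by nra.
have h7 : 2 <= (2 * e) * (1 - t ^+ 2).
  have : 0 <= t ^+ 2 by exact: sqr_ge0.
  move: (t ^+ 2) t4 h3 {h6 h1 h2 h4 h5} => q; nra.
rewrite -(@ler_pM2r _ (1 - t ^+ 2)); [exact: le_trans h7|lra].
Qed.

(** Independent factors: each sign contributes a factor [cosh (l a_k)]. *)
Lemma sign_mean_expR a l m d c :
  sign_mean a (fun x => expR (l * x)) m d c <=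
  expR (l * c) * expR (2 * l ^+ 2 * sq_sum a m d).
Proof.
elim: d m c => [|d IH] m c /=.
  by rewrite /sq_sum addn0 big_geq // mulr0 expR0 mulr1.
have := IH m.+1 (c + a m.+1); have := IH m.+1 (c - a m.+1).
rewrite sq_sum_recl !mulrDr mulrN !expRD.
have := cosh_le_expR (l * a m.+1); rewrite exprMn [2 * (_ * _)]mulrA.
have := expR_gt0 (l * c); have := expR_gt0 (2 * l ^+ 2 * sq_sum a m.+1 d).
move: (sign_mean _ _ _ _ _) (sign_mean _ _ _ _ _) => A B.
move: (expR (l * c)) (expR (l * a _)) (expR (- _)) => C u v.
move: (expR (_ * sq_sum _ _ _)) => S; move: (expR _) => e S0 C0 ch hB hA.
have : 0 <= C * S * (2 * e - (u + v)).
  by rewrite !mulr_ge0 ?(ltW C0, ltW S0) ?subr_ge0.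
lra.
Qed.

(** The [p]-th power of [t <= p exp (t / p)]. *)
Lemma powR_le_expR p t : 1 <= p -> 0 <= t -> t `^ p <= p `^ p * expR t.
Proof.
move=> p1 t0; have p0 : 0 < p by lra.
have -> : expR t = expR (t / p) `^ p by rewrite -expRM divfK ?gt_eqF.
have p0' := ltW p0; rewrite -powRM ?expR_ge0//.
apply: ge0_ler_powR; rewrite ?nnegrE ?mulr_ge0 ?expR_ge0//.
have := expR_ge1Dx (t / p); rewrite -(ler_pM2l p0) mulrDr mulrCA.
rewrite divff ?gt_eqF//; lra.
Qed.

(** The upper Khintchine inequality for a tail of size [s] shifted by a head
    [c] of size [s sqrt m], the situation met on a dyadic interval of level [m].
    Head and tail are treated together: with [y = |x - c| / s],
    [|x| <= s sqrt (m + 1) (1 + y)], and [powR_le_expR] bounds the [p]-th power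
    by [exp (1 + y)], whose average is controlled by exponential moments. *)
Lemma sign_mean_powR_le p s a m d c : 1 <= p -> 0 < s ->
  sq_sum a m d <= s ^+ 2 -> c ^+ 2 <= m%:R * s ^+ 2 ->
  sign_mean a (fun x => `|x| `^ p) m d c <=
  (s * Num.sqrt m.+1%:R * p) `^ p * (2 * expR 3).
Proof.
move=> p1 s0 qs cs; have p0 : 0 < p by lra.
set M := Num.sqrt m.+1%:R.
have M1 : 1 <= M by rewrite -[leLHS]sqrtr1 ler_sqrt ?ler1n ?ltr0n.
have M0 : 0 <= M by lra.
have s0' := ltW s0.
have M2 : M ^+ 2 = m.+1%:R by rewrite sqr_sqrtr ?ler0n.
have cM : `|c| <= s * M.
  rewrite -(@ler_pXn2r _ 2) ?nnegrE ?mulr_ge0//.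
  rewrite exprMn M2 real_normK ?num_real// mulrC (le_trans cs)//.
  by rewrite ler_wpM2r ?sqr_ge0// ler_nat.
(* [K] is abstract, so that rewriting keeps its product together. *)
have [K KE] : exists K, K = (s * M * p) `^ p * expR 1.
  by exists ((s * M * p) `^ p * expR 1).
have K0 : 0 <= K by rewrite KE mulr_ge0 ?powR_ge0 ?expR_ge0.
pose l := s^-1.
have l0 : 0 < l by rewrite invr_gt0.
have ls : l * s = 1 by rewrite mulVf ?gt_eqF.
(* [exp y <= exp (l (x - c)) + exp (- l (x - c))], to average termwise. *)
pose G x := (K * expR (- (l * c))) * expR (l * x)
          + (K * expR (l * c)) * expR (- l * x).
have FG x : `|x| `^ p <= G x.
  pose y := l * `|x - c|.
  have y0 : 0 <= y by rewrite mulr_ge0// ltW.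
  have sy : s * y = `|x - c| by rewrite /y mulrA [s * l]mulrC ls mul1r.
  have : `|x| <= (s * M) * (1 + y).
    have : `|x| <= `|c| + `|x - c|.
      by rewrite (le_trans _ (ler_normD _ _))// addrC subrK.
    by rewrite -sy; have := mulr_ge0 (ltW s0) y0; nra.
  move=> h; apply: (@le_trans _ _ ((s * M * (1 + y)) `^ p)).
    by apply: ge0_ler_powR; rewrite ?nnegrE ?mulr_ge0//; lra.
  have sM : 0 <= s * M by rewrite mulr_ge0.
  have y1 : 0 <= 1 + y by lra.
  rewrite powRM //.
  apply: (@le_trans _ _ (K * expR y)).
    rewrite KE [(_ * p) `^ _]powRM ?(ltW p0)//.
    rewrite -!mulrA ler_wpM2l ?powR_ge0// -expRD.
    by apply: powR_le_expR => //; lra.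
  rewrite /G -!mulrA -mulrDr ler_wpM2l// -!expRD.
  have [xc|xc] := leP 0 (x - c).
    have -> : - (l * c) + l * x = y by rewrite /y ger0_norm//; ring.
    by rewrite lerDl expR_ge0.
  have -> : l * c + - l * x = y by rewrite /y ltr0_norm//; ring.
  by rewrite lerDr expR_ge0.
apply: (le_trans (le_sign_mean a m d c FG)).
rewrite sign_mean_comb.
have := sign_mean_expR a l m d c; have := sign_mean_expR a (- l) m d c.
rewrite sqrrN mulNr.
have hE : expR (2 * l ^+ 2 * sq_sum a m d) <= expR 2.
  rewrite ler_expR -mulrA ler_piMr//.
  by rewrite (le_trans (ler_wpM2l (sqr_ge0 l) qs))// -exprMn ls expr1n.
have -> : expR 3 = expR 1 * expR 2 :> R by rewrite -expRD; congr expR; lra.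
have := expRxMexpNx_1 (l * c).
have := expR_gt0 (l * c); have := expR_gt0 (- (l * c)).
move: (sign_mean _ _ _ _ _) (sign_mean _ _ _ _ _) => A B.
have := expR_gt0 (2 * l ^+ 2 * sq_sum a m d).
move: hE.
move: (expR (l * c)) (expR (- _)) (expR _) (expR 2) => u v E e2.
move=> hE E0 v0 u0 uv hB hA.
have h1 : v * A <= E by rewrite (le_trans (ler_wpM2l (ltW v0) hA))// mulrA; nra.
have h2 : u * B <= E by rewrite (le_trans (ler_wpM2l (ltW u0) hB))// mulrA; nra.
rewrite [leRHS](_ : _ = K * (2 * e2)); last by rewrite KE; ring.
by rewrite -!mulrA -mulrDr ler_wpM2l//; lra.
Qed.

(** The lower Khintchine inequality, by a Paley-Zygmund argument: with
    [q = x^2 / s^2], the polynomial [4/7 q - q^2 / 14 - 1/7] is at most [1]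
    everywhere and nonpositive for [q <= 1/4], so it lies below the indicator
    of [|x| >= s / 2].  Its average is at least [4/7 - 3/14 - 1/7 = 3/14], the
    fourth moment being at most [3 s^4]. *)
Lemma sign_mean_powR_ge p s a m d : 1 <= p -> 0 < s ->
  sq_sum a m d = s ^+ 2 ->
  (s / 2) `^ p * (3 / 14) <= sign_mean a (fun x => `|x| `^ p) m d 0.
Proof.
move=> p1 s0 qs.
have [K KE] : exists K, K = (s / 2) `^ p by exists ((s / 2) `^ p).
have K0 : 0 <= K by rewrite KE powR_ge0.
pose l := s^-1.
have l0 : 0 < l by rewrite invr_gt0.
have ls : l * s = 1 by rewrite mulVf ?gt_eqF.
pose G x := 1 * (K * (4 / 7) * l ^+ 2 * x ^+ 2 + (- (K * l ^+ 4 / 14)) * x ^+ 4)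
            + (- (K / 7)) * cst 1 x.
have FG x : G x <= `|x| `^ p.
  have -> : G x = K * (4 / 7 * (l * `|x|) ^+ 2 - (l * `|x|) ^+ 4 / 14 - 1 / 7).
    rewrite /G/= !exprMn real_normK ?num_real//.
    by rewrite (exprM `|x| 2 2) real_normK ?num_real//; ring.
  set y := l * `|x|; have y0 : 0 <= y by rewrite mulr_ge0// ltW.
  have [y2|y2] := leP y 2^-1.
    apply: (@le_trans _ _ 0); last exact: powR_ge0.
    by rewrite mulr_ge0_le0//; nra.
  apply: (@le_trans _ _ K).
    rewrite ler_piMr//; have := sqr_ge0 (y ^+ 2 - 4).
    by have := sqr_ge0 (y ^+ 2); nra.
  rewrite KE; apply: ge0_ler_powR; rewrite ?nnegrE//; [lra|lra|].
  have -> : `|x| = s * y by rewrite /y mulrA [s * l]mulrC ls mul1r.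
  by rewrite ler_wpM2l ?(ltW s0, ltW y2).
apply: le_trans (le_sign_mean a m d 0 FG).
rewrite sign_mean_comb sign_mean_comb sign_mean_cst sign_mean_sqr qs.
have := sign_mean_pow4 a m d 0; rewrite qs.
have -> : K * (4 / 7) * l ^+ 2 * (0 ^+ 2 + s ^+ 2) = K * (4 / 7) * (l * s) ^+ 2.
  by rewrite exprMn; ring.
rewrite ls expr1n !expr0n/= !mulr0 mul0r !add0r mulr1 => h.
have : K * l ^+ 4 / 14 * sign_mean a (fun x => x ^+ 4) m d 0 <= K * (3 / 14).
  apply: (@le_trans _ _ (K * l ^+ 4 / 14 * (3 * (s ^+ 2) ^+ 2))).
    have l4 : 0 <= l ^+ 4 by apply/exprn_ge0/ltW.
    have Kl : 0 <= K * l ^+ 4 by rewrite mulr_ge0.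
    by rewrite ler_wpM2l//; lra.
  have -> : K * l ^+ 4 / 14 * (3 * (s ^+ 2) ^+ 2) = K * (3 / 14) * (l * s) ^+ 4.
    by ring.
  by rewrite ls expr1n mulr1.
by rewrite -KE; lra.
Qed.
End SignMean.

(** * Rademacher sums on dyadic intervals *)

Section Rademacher.
Variable R : realType.
Implicit Types (a : nat -> R) (f : R -> R) (c t p : R) (m d n j k : nat).
Local Notation mu := (@lebesgue_measure R).

Lemma rademacher_dyadic k j t : j%:R < 2 ^+ k * t < j.+1%:R ->
  rademacher k t = (-1) ^+ j.
Proof.
move=> /andP[jt tj]; rewrite /rademacher.
have -> : 2 ^+ k * pi * t = (2 ^+ k * t - j%:R) * pi + pi *+ j :> R by ring.
rewrite (alternatingn (@sinDpi R)) sgrM sgrX sgrN1.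
rewrite [X in _ * X]gtr0_sg ?mulr1// sin_gt0_pi// mulr_gt0 ?pi_gt0 ?subr_gt0//=.
by rewrite gtr_pMl ?pi_gt0//; move: tj; rewrite -natr1; lra.
Qed.

Lemma measurable_rademacher k : measurable_fun setT (@rademacher R k).
Proof.
apply: (@measurableT_comp _ _ _ _ _ _ (@Num.sg R)).
  by apply: nondecreasing_measurable => // x y; do 2 case: sgrP; lra.
apply: (@measurableT_comp _ _ _ _ _ _ (@sin R)).
  by apply: continuous_measurable_fun; exact: continuous_sin.
exact: measurable_funM.
Qed.

Definition rad_sum a n t : R := \sum_(1 <= k < n.+1) a k * rademacher k t.

Lemma rad_sumS a n t :
  rad_sum a n.+1 t = rad_sum a n t + a n.+1 * rademacher n.+1 t.
Proof. by rewrite /rad_sum big_nat_recr. Qed.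

(** Cauchy-Schwarz with [|r_k| <= 1]. *)
Lemma rad_sum_sqr_le a n t : rad_sum a n t ^+ 2 <= n%:R * sq_sum a 0 n.
Proof.
rewrite /sq_sum add0n; elim: n => [|n IH].
  by rewrite /rad_sum !big_geq// mul0r expr0n.
rewrite rad_sumS [\sum_(1 <= i < n.+2) _]big_nat_recr//=.
have : (a n.+1 * rademacher n.+1 t) ^+ 2 <= a n.+1 ^+ 2.
  rewrite exprMn ler_piMr ?sqr_ge0// /rademacher.
  by case: sgrP; rewrite ?expr0n ?sqrrN ?expr1n.
have : 0 <= \sum_(1 <= i < n.+1) a i ^+ 2.
  by apply: sumr_ge0 => k _; exact: sqr_ge0.
move: IH; rewrite -natr1; have := ler0n R n.
move: (rad_sum a n t) (a n.+1 * _) (\sum_(_ <= i < _) _) (a n.+1 ^+ 2) (n%:R).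
move=> x y A b N N0 xA A0 yb.
have b0 : 0 <= b by apply: le_trans yb; exact: sqr_ge0.
have Nb : 0 <= A + N * b by rewrite addr_ge0 ?mulr_ge0.
have xyb : x ^+ 2 * y ^+ 2 <= (N * A) * b by rewrite ler_pM ?sqr_ge0.
have : 2 * x * y <= A + N * b.
  rewrite (le_trans (ler_norm _))// -(@ler_pXn2r _ 2) ?nnegrE//.
  rewrite real_normK ?num_real//.
  by have := sqr_ge0 (A - N * b); lra.
lra.
Qed.

Lemma measurable_rad_sum a n : measurable_fun setT (rad_sum a n).
Proof.
apply: measurable_sum => k; apply: measurable_funM => //.
exact: measurable_rademacher.
Qed.

(** Half-open, so that a dyadic interval is the disjoint union of its halves. *)
Definition dyadic_itv m j : interval R :=
  `[j%:R / 2 ^+ m, j.+1%:R / 2 ^+ m[.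

(** Halving the interval decides the sign of [r_(m+1)], which is [1] on the left
    half and [-1] on the right half; this is the recursion of [sign_mean].  The
    hypothesis concerns interior points only, because [r_m] vanishes at the
    endpoints. *)
Lemma integral_rad_sum_dyadic a f m d j c :
  measurable_fun setT f -> (forall x, 0 <= f x) ->
  (forall t, j%:R < 2 ^+ m * t < j.+1%:R -> rad_sum a m t = c) ->
  (\int[mu]_(t in [set` dyadic_itv m j]) (f (rad_sum a (m + d) t))%:E =
   (sign_mean a f m d c / 2 ^+ m)%:E)%E.
Proof.
move=> mf f0; elim: d m j c => [|d IH] m j c hc.
  have p2 : 0 < 2 ^+ m :> R by rewrite exprn_gt0.
  rewrite addn0 /dyadic_itv -integral_itv_obnd_cbnd; last first.
    apply: measurableT_comp => //; apply: measurable_funTS.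
    by apply: measurableT_comp => //; exact: measurable_rad_sum.
  rewrite (eq_integral (cst (f c)%:E)); last first.
    move=> t; rewrite inE/= in_itv/= ltr_pdivrMr// ltr_pdivlMr//.
    by rewrite ![t * _]mulrC => /hc ->.
  rewrite integral_cst//= lebesgue_measure_itv/= lte_fin ltr_pM2r ?invr_gt0//.
  rewrite ltr_nat leqnn -EFinB -EFinM; congr (_%:E).
  by rewrite -mulrBl -natr1 addrAC subrr add0r mul1r.
have p2 : 2 ^+ m.+1 = 2 * 2 ^+ m :> R by rewrite exprS.
have h2 : 2 ^+ m != 0 :> R by rewrite gt_eqF ?exprn_gt0.
have half k : k%:R / 2 ^+ m = k.*2%:R / 2 ^+ m.+1 :> R.
  by rewrite p2 -muln2 natrM; field.
have p0 : 0 < 2 ^+ m.+1 :> R by rewrite exprn_gt0.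
have -> : [set` dyadic_itv m j] =
    [set` dyadic_itv m.+1 j.*2] `|` [set` dyadic_itv m.+1 j.*2.+1].
  rewrite /dyadic_itv (half j) (half j.+1) doubleS.
  by apply: itv_bndbnd_setU; rewrite bnd_simp ler_pM2r ?invr_gt0// ler_nat.
have hS i t : i%:R < 2 ^+ m.+1 * t < i.+1%:R -> (i./2 = j)%N ->
    rad_sum a m.+1 t = c + a m.+1 * (-1) ^+ i.
  move=> it ij; rewrite rad_sumS (rademacher_dyadic it) hc//.
  have ij2 : (j.*2 <= i < j.*2.+2)%N by lia.
  move: it; rewrite p2 -mulrA => /andP[i1 i2].
  have l1 : j%:R * 2 <= i%:R :> R by rewrite -natrM muln2 ler_nat; lia.
  have l2 : i.+1%:R <= j.+1%:R * 2 :> R by rewrite -natrM muln2 ler_nat; lia.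
  lra.
rewrite ge0_integral_setU//=.
- rewrite addnS -addSn (IH _ _ (c + a m.+1)); last first.
    by move=> t /hS h; rewrite h ?doubleK// -signr_odd odd_double mulr1.
  rewrite (IH _ _ (c - a m.+1)); last first.
    move=> t /hS h; rewrite h; last by lia.
    by rewrite -signr_odd/= odd_double mulrN1.

  by rewrite -EFinD p2; congr EFin; field.
- apply: measurableT_comp => //; apply: measurable_funTS.
  by apply: measurableT_comp => //; exact: measurable_rad_sum.
- by move=> x _; rewrite lee_fin.
- apply/disj_setPS => x /=; rewrite !in_itv/= => -[/andP[_ h] /andP[]].
  by rewrite leNgt h.
Qed.

(** The first [m] Rademacher functions are constant inside a dyadic interval of
    level [m]; the size of their sum is then read off at the midpoint. *)
Lemma rad_sum_head a m j : exists2 c, c ^+ 2 <= m%:R * sq_sum a 0 m &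
  forall t, j%:R < 2 ^+ m * t < j.+1%:R -> rad_sum a m t = c.
Proof.
have p2 n : 0 < 2 ^+ n :> R by rewrite exprn_gt0.
suff [c hc] : exists c,
    forall t, j%:R < 2 ^+ m * t < j.+1%:R -> rad_sum a m t = c.
  exists c => //; rewrite -(hc ((j%:R + 2^-1) / 2 ^+ m)) ?rad_sum_sqr_le//.
  by rewrite mulrCA divff ?gt_eqF// mulr1 -[j.+1%:R]natr1;
    apply/andP; split; lra.
elim: m j => [|m IH] j; first by exists 0 => t _; rewrite /rad_sum big_geq.
have [c hc] := IH j./2; exists (c + a m.+1 * (-1) ^+ j) => t jt.
rewrite rad_sumS (rademacher_dyadic jt) hc//.
move: jt; rewrite exprS -mulrA => /andP[i1 i2].
have l1 : j./2%:R * 2 <= j%:R :> R by rewrite -natrM muln2 ler_nat; lia.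
have l2 : j.+1%:R <= j./2.+1%:R * 2 :> R by rewrite -natrM muln2 ler_nat; lia.
lra.
Qed.
End Rademacher.

(** * The Morrey norm of a Rademacher sum *)

Section Morrey.
Variable R : realType.
Implicit Types (a : nat -> R) (w : R -> R) (c t p s K : R) (m d n j k : nat).
Local Notation mu := (@lebesgue_measure R).

Lemma dyadic_scale t : 0 < t <= 1 ->
  exists m, 2 ^+ m * t <= 1 /\ 1 < 2 ^+ m.+1 * t.
Proof.
move=> /andP[t0 t1].
have [|m hm min] := @ex_minnP (fun m => 1 < 2 ^+ m * t).
  exists (Num.truncn t^-1).+1; rewrite mulrC -ltr_pdivrMl// mulr1.
  apply: lt_trans (truncnS_gt _) _; rewrite -natrX ltr_nat; exact: ltn_expl.
case: m hm min => [|m] hm min; first by move: hm; rewrite expr0 mul1r ltNge t1.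
exists m; split => //; rewrite leNgt; apply/negP => /min; by rewrite ltnn.
Qed.

Lemma log2_expr2 n : log2 (2 ^+ n : R) = n%:R.
Proof.
rewrite /log2 lnXn// -[ln 2 *+ n]mulr_natr mulrAC divff ?mul1r//.
by rewrite gt_eqF// ln_gt0//; lra.
Qed.

Lemma le_log2 s t : 0 < s -> s <= t -> log2 s <= log2 t.
Proof.
move=> s0 st; rewrite /log2 ler_pM2r ?invr_gt0 ?ln_gt0//; last lra.
by rewrite ler_ln// posrE; lra.
Qed.

Lemma log2_scale_ge m t : 0 < t -> 2 ^+ m * t <= 1 -> m.+1%:R <= log2 (2 / t).
Proof.
move=> t0 mt; rewrite -(log2_expr2 m.+1) le_log2 ?exprn_gt0// ler_pdivlMr//.
by rewrite exprS; lra.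
Qed.

Lemma log2_scale_le m t : 0 < t -> 1 < 2 ^+ m.+1 * t -> log2 (2 / t) <= m.+2%:R.
Proof.
move=> t0 mt; rewrite -(log2_expr2 m.+2) le_log2 ?divr_gt0// ler_pdivrMr//.
by rewrite (exprS _ m.+1); lra.
Qed.

Lemma rad_sum_cst1 n t : 0 < 2 ^+ n * t < 1 -> rad_sum (cst 1) n t = n%:R.
Proof.
elim: n => [|n IH] nt; first by rewrite /rad_sum big_geq.
rewrite rad_sumS (@rademacher_dyadic _ _ 0)// IH ?expr0 ?mulr1 ?natr1//.
by move: nt; rewrite exprS; lra.
Qed.

Lemma measurable_rad_sum_powR a n p D :
  measurable_fun D (fun t => (`|rad_sum a n t| `^ p)%:E).
Proof.
apply: measurable_funTS; apply: measurableT_comp => //.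
apply: (@measurableT_comp _ _ _ _ _ _ (@powR R ^~ p)) => //.
by apply: measurableT_comp => //; exact: measurable_rad_sum.
Qed.

Lemma integral_powR_dyadic a m d j c p :
  (forall t, j%:R < 2 ^+ m * t < j.+1%:R -> rad_sum a m t = c) ->
  (\int[mu]_(t in [set` dyadic_itv R m j]) (`|rad_sum a (m + d) t| `^ p)%:E =
   (sign_mean a (fun x => `|x| `^ p) m d c / 2 ^+ m)%:E)%E.
Proof.
apply: (@integral_rad_sum_dyadic _ a (fun x => `|x| `^ p)) => [|x].
  apply: (@measurableT_comp _ _ _ _ _ _ (@powR R ^~ p)) => //.
exact: powR_ge0.
Qed.

(** The term of the supremum for the interval [[0, 2^-m]]. *)
Lemma morrey_norm_ge_dyadic p w a m d c :
  (forall t, 0 < 2 ^+ m * t < 1 -> rad_sum a m t = c) ->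
  ((w (2 ^- m) * sign_mean a (fun x => `|x| `^ p)%R m d c `^ p^-1)%:E <=
   morrey_norm p w (rad_sum a (m + d)))%E.
Proof.
move=> hc; apply: ereal_sup_ubound.
have p2 : 0 < 2 ^+ m :> R by rewrite exprn_gt0.
have p2V : 0 < 2 ^- m :> R by rewrite invr_gt0.
have mI : mu `[0, 2 ^- m] = (2 ^- m)%:E.
  by rewrite lebesgue_measure_itv/= lte_fin p2V -EFinB subr0.
exists `[0, 2 ^- m]; first split.
- move=> t /=; rewrite !in_itv/= => /andP[-> h]; apply: le_trans h _.
  by rewrite invf_le1// exprn_ege1// ler1n.
- by rewrite /= mI lte_fin.
rewrite /itv_length mI/= invrK -(@integral_itv_bndo_bndc R); last first.
  exact: measurable_rad_sum_powR.
have -> : `[0, 2 ^- m[ = dyadic_itv R m 0 by rewrite /dyadic_itv mul0r mul1r.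
rewrite (integral_powR_dyadic d p (c := c))//.
by rewrite -EFinM mulrCA divff ?mulr1 ?gt_eqF.
Qed.

Lemma sq_sumD a m d : sq_sum a 0 (m + d) = sq_sum a 0 m + sq_sum a m d.
Proof. by rewrite /sq_sum !add0n -big_cat_nat//= ltnS leq_addr. Qed.

Lemma sum_truncate (F : R -> nat -> R) a m n : (forall k, F 0 k = 0) ->
  \sum_(1 <= k < (m + n).+1) F (if (k <= n)%N then a k else 0) k =
  \sum_(1 <= k < n.+1) F (a k) k.
Proof.
move=> F0; rewrite (big_cat_nat (n := n.+1))//= ?ltnS ?leq_addl//.
rewrite [X in _ + X]big_nat_cond [X in _ + X]big1 ?addr0; last first.
  by move=> k /andP[/andP[nk _] _]; rewrite leqNgt nk F0.
by apply: eq_big_nat => k /andP[_ kn]; rewrite -ltnS kn.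
Qed.

(** The index [j] is the integer part of [2^m] times the left end of [I]; the
    right end is at most [2^-m] further, hence before [(j + 2) / 2^m]. *)
Lemma subitv01_cover (I : interval R) : nondegenerate_subitv01 I ->
  [/\ 0 < itv_length I <= 1, mu [set` I] = (itv_length I)%:E &
  forall m, 2 ^+ m * itv_length I <= 1 -> exists j,
    [set` I] `<=` [set` dyadic_itv R m j] `|` [set` dyadic_itv R m j.+1]].
Proof.
move=> [I01 I0].
have mI1 : (mu [set` I] <= 1)%E.
  apply: (@le_trans _ _ (mu `[0, 1])).
    by apply: le_measure => //; rewrite inE; exact: measurable_itv.
  by rewrite lebesgue_measure_itv/= lte_fin ltr01 -EFinB subr0.
have mI : mu [set` I] = (itv_length I)%:E.
  by rewrite fineK// ge0_fin_numE// (le_lt_trans mI1)// ltry.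
have l1 : itv_length I <= 1 by rewrite -lee_fin -mI.
have l0 : 0 < itv_length I by rewrite -lte_fin -mI.
split => //; first by rewrite l0 l1.
move=> m ml.
have {mI1 I0 l1} : exists x y, [/\ 0 <= x, itv_length I = y - x &
    forall t, t \in I -> x <= t <= y].
  move: (itv_length I) l0 mI {ml mI1 l1 I0} => l l0.
  rewrite lebesgue_measure_itv/=.
  have nl : 0%E = l%:E -> False by move=> [] ll; rewrite -ll ltxx in l0.
  case: I I01 => -[b x|[]] [b' y|[]] I01 //=;
    (try case: ifP => xy); try by [|move=> /nl].
  move: xy; rewrite -EFinB => xy [ll].
  exists x, y; split => //; last first.
    by move=> t; rewrite in_itv/= => /andP[/lteifW -> /lteifW ->].
  rewrite lte_fin in xy; rewrite leNgt; apply/negP => x0.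
  pose z := (x + Num.min y 0) / 2.
  have [xm my m0] : [/\ x < Num.min y 0, Num.min y 0 <= y & Num.min y 0 <= 0].
    by rewrite lt_min xy x0 !ge_min !lexx ?orbT.
  have : `[0, 1]%classic z.
    apply: I01 => /=; rewrite in_itv/=.
    by apply/andP; split; apply: lteifS; rewrite /z; lra.
  by rewrite /= in_itv/= /z; lra.
move=> [x [y [x0 lE xyI]]].
have p2 : 0 < 2 ^+ m :> R by rewrite exprn_gt0.
have /truncn_itv/andP[] : 0 <= 2 ^+ m * x by rewrite mulr_ge0 ?(ltW p2).
set j := Num.truncn _ => jx xj; exists j => t /= /xyI /andP[xt ty].
rewrite !in_itv/= !ler_pdivrMr// !ltr_pdivlMr// [t * _]mulrC.
have ht : 2 ^+ m * x <= 2 ^+ m * t by rewrite ler_pM2l.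
have : 2 ^+ m * t <= 2 ^+ m * y by rewrite ler_pM2l.
move: ml; rewrite lE mulrBr; move: xj; rewrite -[j.+2%:R]natr1 => *.
by have [_|h] := ltP (2 ^+ m * t) j.+1%:R; [left|right]; lra.
Qed.

(** The bound is stated for a positive [s] above the [l_2] norm, rather than for
    the norm itself, since the proof divides by it. *)
Lemma morrey_norm_le p w a n s K : 1 <= p -> 0 < s ->
  (forall t, 0 < t <= 1 -> 0 <= w t) ->
  (forall t, 0 < t <= 1 -> w t * Num.sqrt (log2 (2 / t)) <= K) ->
  sq_sum a 0 n <= s ^+ 2 ->
  (morrey_norm p w (rad_sum a n) <= (K * (p * (8 * expR 3)) * s)%:E)%E.
Proof.
move=> p1 s0 w0 wK qs; apply: ge_ereal_sup => _ [I /subitv01_cover hI <-].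
move: hI; set l := itv_length I => -[l01 mI cover].
have [m [ml lm]] := dyadic_scale l01; have [j {}cover] := cover m ml.
have /andP[l0 l1] := l01.
have p2 : 0 < 2 ^+ m :> R by rewrite exprn_gt0.
(* Pad with zeros so that the sum reaches past the level [m] of the cover. *)
pose b k := if (k <= n)%N then a k else 0.
have bE : rad_sum a n = rad_sum b (m + n).
  apply/funext => t; apply/esym.
  by apply: (@sum_truncate (fun x k => x * rademacher k t)) => k; rewrite mul0r.
have qb : sq_sum b 0 m + sq_sum b m n <= s ^+ 2.
  rewrite -sq_sumD (le_trans _ qs)// /sq_sum !add0n.
  by rewrite (@sum_truncate (fun x k => x ^+ 2))// => k; rewrite expr0n.
pose B := (s * Num.sqrt m.+1%:R * p) `^ p * (2 * expR 3).
have B0 : 0 <= B by rewrite mulr_ge0 ?powR_ge0// mulr_ge0 ?expR_ge0.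
have hB i : (\int[mu]_(t in [set` dyadic_itv R m i]) (`|rad_sum a n t| `^ p)%:E
    <= (B / 2 ^+ m)%:E)%E.
  have [c hc hd] := rad_sum_head b m i.
  rewrite bE (integral_powR_dyadic n p hd) lee_fin ler_pM2r ?invr_gt0//.
  apply: sign_mean_powR_le => //.
    by have := sq_sum_ge0 b 0 m; lra.
  by rewrite (le_trans hc)// ler_wpM2l//; have := sq_sum_ge0 b m n; lra.
have hI : (\int[mu]_(t in [set` I]) (`|rad_sum a n t| `^ p)%:E
    <= (2 * (B / 2 ^+ m))%:E)%E.
  apply: (@le_trans _ _ (\int[mu]_(t in [set` dyadic_itv R m j] `|`
      [set` dyadic_itv R m j.+1]) (`|rad_sum a n t| `^ p)%:E)%E).
    apply: ge0_subset_integral => //; first exact: measurableU.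
    exact: measurable_rad_sum_powR.
  rewrite ge0_integral_setU//=; last 2 first.
  - exact: measurable_rad_sum_powR.
  - apply/disj_setPS => x /=; rewrite !in_itv/= => -[/andP[_ h] /andP[]].
    by rewrite leNgt h.
  by rewrite mulr_natl mulr2n EFinD leeD.
have e1 : 1 <= 8 * expR 3 :> R by have := expR_ge1Dx (3 : R); lra.
(* [1 / 2^m < 2 l]: two dyadic intervals have at most four times the length
   of [I]. *)
have hA : ((l^-1)%:E * \int[mu]_(t in [set` I]) (`|rad_sum a n t| `^ p)%:E
    <= ((s * Num.sqrt m.+1%:R * p) `^ p * (8 * expR 3))%:E)%E.
  apply: (@le_trans _ _ ((l^-1)%:E * (2 * (B / 2 ^+ m))%:E)%E).
    by rewrite lee_wpmul2l// lee_fin invr_ge0 ltW.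
  rewrite -EFinM lee_fin ler_pdivrMl// mulrA ler_pdivrMr//.
  have : B * 1 <= B * (2 ^+ m.+1 * l) by rewrite ler_wpM2l// ltW.
  by rewrite exprS /B; lra.
have hP : (((l^-1)%:E * \int[mu]_(t in [set` I]) (`|rad_sum a n t| `^ p)%:E)
    `^ p^-1 <= (s * Num.sqrt m.+1%:R * p * (8 * expR 3))%:E)%E.
  apply: (@le_trans _ _ (((s * Num.sqrt m.+1%:R * p) `^ p * (8 * expR 3))
      `^ p^-1)%:E).
    rewrite -poweR_EFin; apply: gt0_ler_poweR => //.
    - by rewrite invr_ge0; lra.
    - rewrite in_itv/= leey andbT mule_ge0 ?lee_fin ?invr_ge0 ?(ltW l0)//.
      by apply: integral_ge0 => t _; rewrite lee_fin powR_ge0.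
    - by rewrite in_itv/= leey andbT lee_fin mulr_ge0 ?powR_ge0//; lra.
  have sp0 : 0 <= s * Num.sqrt m.+1%:R * p.
    by rewrite !mulr_ge0 ?sqrtr_ge0//; lra.
  have e0 : 0 <= 8 * expR 3 :> R by lra.
  have p0 : 0 < p by lra.
  rewrite lee_fin powRM ?powR_ge0//.
  rewrite -powRrM divff ?powRr1 ?gt_eqF//.
  by rewrite ler_wpM2l// ler1_powR// invf_le1.
apply: le_trans (lee_wpmul2l _ hP) _; first by rewrite lee_fin w0.
rewrite -EFinM lee_fin.
have : w l * Num.sqrt m.+1%:R <= K.
  apply: le_trans (wK l l01); rewrite ler_wpM2l ?w0// ler_wsqrtr//.
  exact: log2_scale_ge.
move=> h.
have -> : w l * (s * Num.sqrt m.+1%:R * p * (8 * expR 3)) =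
    w l * Num.sqrt m.+1%:R * (p * (8 * expR 3) * s) by ring.
rewrite -[leRHS]mulrA ler_wpM2r// !mulr_ge0//; lra.
Qed.
End Morrey.

(** * Equivalence with the unit vector basis *)

Lemma sq_sum_sqrt (R : realType) (a : nat -> R) n :
  Num.sqrt (sq_sum a 0 n) ^+ 2 = sq_sum a 0 n.
Proof. by rewrite sqr_sqrtr ?sq_sum_ge0. Qed.

Lemma morrey_norm_ge (R : realType) (p : R) (w : R -> R) a n :
  1 <= p -> w 1 = 1 ->
  ((3 / 28 * Num.sqrt (sq_sum a 0 n))%:E <= morrey_norm p w (rad_sum a n))%E.
Proof.
move=> p1 w1; have p0 : 0 < p by lra.
have := @morrey_norm_ge_dyadic R p w a 0 n 0.
rewrite expr0 invr1 w1 mul1r add0n => H.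
apply: (@le_trans _ _ _ _ _ _ (H _)); last first.
  by move=> t _; rewrite /rad_sum big_geq.
set s := Num.sqrt _; rewrite lee_fin.
have [s0|s0] := leP s 0.
  by apply: le_trans (powR_ge0 _ _); lra.
have h := sign_mean_powR_ge p1 s0 (esym (sq_sum_sqrt a n)).
apply: (@le_trans _ _ (((s / 2) `^ p * (3 / 14)) `^ p^-1)).
  have s2 : 0 <= s / 2 by lra.
  rewrite powRM ?powR_ge0//.
  rewrite -powRrM divff ?powRr1 ?gt_eqF//.
  have : (3 / 14 : R) `^ 1 <= (3 / 14) `^ p^-1.
    by apply: ger_powR; [apply/andP; split; lra|rewrite invf_le1].
  rewrite powRr1; last lra.
  by move=> h'; have := ler_wpM2l s2 h'; lra.
apply: ge0_ler_powR; rewrite ?nnegrE ?invr_ge0 ?(ltW p0)//.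
  by rewrite mulr_ge0 ?powR_ge0//; lra.
by apply: le_trans h; rewrite mulr_ge0 ?powR_ge0//; lra.
Qed.

Lemma rad_sum_delta (R : realType) k :
  (0 < k)%N -> @rademacher R k = rad_sum (fun i => (i == k)%:R) k.
Proof.
case: k => // k _; apply/funext => t; rewrite rad_sumS eqxx mul1r /rad_sum.
rewrite big_nat_cond big1 ?add0r// => i /andP[/andP[_ ik] _].
by rewrite ltn_eqF ?mul0r.
Qed.

Theorem corollary2 (R : realType) (p : R) (w : R -> R)
    (hp : 1 <= p) (hw : quasi_concave w) (hw1 : w 1 = 1) :
  rademacher_span_l2 p w <->
  (ereal_sup [set (w t * Num.sqrt (log2 (2 / t)))%:E | t in `]0%R, 1%R]]
     < +oo)%E.
Proof.
have [_ w0 wmono _] := hw; have p0 : 0 < p by lra.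
split=> [[_ [C C1 HC]]|supK].
  apply: (@le_lt_trans _ _ (2 * C)%:E); last exact: ltry.
  apply: ge_ereal_sup => _ [t + <-]; rewrite /= in_itv/= => t01.
  have /andP[t0 t1] := t01; rewrite lee_fin.
  have [n [nt tn]] := dyadic_scale t01.
  have wt1 : w t <= 1 by rewrite -hw1 wmono// ltW.
  have wt0 : 0 <= w t by rewrite w0// (ltW t0).
  have lg := log2_scale_le t0 tn.
  (* At the top scale [t > 1/2] there is no sum to test; [w 1 = 1] suffices. *)
  case: n nt tn lg => [|n] nt tn lg.
    apply: (@le_trans _ _ (1 * 2)); last lra.
    rewrite ler_pM ?sqrtr_ge0// (le_trans (ler_wsqrtr lg))//.
    by rewrite -[leRHS](@ger0_norm _ 2)// -sqrtr_sqr ler_wsqrtr//; lra.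
  have p2 : 0 < 2 ^+ n.+1 :> R by rewrite exprn_gt0.
  have tn' : t <= 2 ^- n.+1 by rewrite -div1r ler_pdivlMr// mulrC.
  have wn : w t <= w (2 ^- n.+1).
    by rewrite wmono ?(ltW t0)// invf_le1// exprn_ege1// ler1n.
  have := @morrey_norm_ge_dyadic R p w (cst 1) n.+1 0 n.+1%:R
    (@rad_sum_cst1 R n.+1).
  rewrite addn0 /= normr_nat -powRrM divff ?powRr1 ?gt_eqF// => h.
  have [_ /(le_trans h)] := HC n.+1 (cst 1) isT.
  rewrite lee_fin; under eq_bigr do rewrite expr1n.
  rewrite big_const_nat subSS subn0 iter_addr_0 => hC.
  set q := Num.sqrt (n.+1%:R : R).
  have q0 : 0 < q by rewrite sqrtr_gt0.
  have qq : q * q = n.+1%:R by rewrite -expr2 sqr_sqrtr.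
  have wq : w (2 ^- n.+1) * q <= C.
    by rewrite -(ler_pM2r q0) -mulrA qq.
  have lq : Num.sqrt (log2 (2 / t)) <= 2 * q.
    have -> : 2 * q = Num.sqrt (4 * n.+1%:R).
      rewrite sqrtrM// (_ : 4 = 2 ^+ 2 :> R); last by rewrite -natrX.
      by rewrite sqrtr_sqr ger0_norm.
    have l3 : n.+3%:R <= 4 * n.+1%:R :> R.
      by rewrite -addn3 -addn1 !natrD; have := ler0n R n; lra.
    by apply: ler_wsqrtr; exact: le_trans l3.
  apply: (@le_trans _ _ (w (2 ^- n.+1) * (2 * q))); last lra.
  by rewrite ler_pM ?sqrtr_ge0.
pose K := fine (ereal_sup [set (w t * Num.sqrt (log2 (2 / t)))%:E
                           | t in `]0%R, 1%R]]).
have wK t : 0 < t <= 1 -> w t * Num.sqrt (log2 (2 / t)) <= K.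
  move=> t01; have h : ((w t * Num.sqrt (log2 (2 / t)))%:E <= ereal_sup
      [set (w t * Num.sqrt (log2 (2 / t)))%:E | t in `]0%R, 1%R]])%E.
    by apply: ereal_sup_ubound; exists t => //=; rewrite in_itv.
  rewrite -lee_fin /K fineK// fin_numE -ltey supK andbT.
  by rewrite -ltNye; apply: lt_le_trans h; exact: ltNyr.
have w0' t : 0 < t <= 1 -> 0 <= w t.
  by move=> /andP[t0 t1]; rewrite w0// (ltW t0).
have K0 : 0 <= K.
  apply: le_trans (wK 1 _); last by rewrite ltr01 lexx.
  by rewrite hw1 mul1r sqrtr_ge0.
pose L := K * (p * (8 * expR 3)).
have L0 : 0 <= L by rewrite !mulr_ge0 ?expR_ge0// ltW.
have upper a n s : 0 < s -> sq_sum a 0 n <= s ^+ 2 ->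
    (morrey_norm p w (rad_sum a n) <= (L * s)%:E)%E.
  by move=> s0 ?; exact: morrey_norm_le.
split.
  move=> k k0; split.
    by apply: measurable_funTS; exact: measurable_rademacher.
  rewrite rad_sum_delta//; set a := fun i => _.
  have h := sq_sum_ge0 a 0 k.
  apply: le_lt_trans (upper a k (1 + sq_sum a 0 k) _ _) (ltry _); first lra.
  by have := sqr_ge0 (sq_sum a 0 k); lra.
(* [L] serves the upper bound and [1 / 10 <= 3 / 28] the lower one. *)
exists (L + 10); first lra.
move=> n a n0 l2 N.
have l2E : l2 = Num.sqrt (sq_sum a 0 n) by rewrite /sq_sum add0n.
have l20 : 0 <= l2 by exact: sqrtr_ge0.
split.
  apply: le_trans (morrey_norm_ge a n hp hw1).
  rewrite lee_fin -l2E ler_wpM2r// invf_ple ?posrE; lra.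
(* [morrey_norm_le] at [l2 + e / (L + 10)], with [e] tending to [0]. *)
apply/lee_addgt0Pr => e e0.
have d0 : 0 < e / (L + 10) by rewrite divr_gt0//; lra.
have de : (L + 10) * (e / (L + 10)) = e.
  by rewrite mulrCA divff ?mulr1// gt_eqF//; lra.
apply: le_trans (upper a n (l2 + e / (L + 10)) _ _) _.
- lra.
- have : sq_sum a 0 n = l2 ^+ 2 by rewrite l2E sq_sum_sqrt.
  by have := mulr_ge0 l20 (ltW d0); have := sqr_ge0 (e / (L + 10)); lra.
rewrite -EFinD lee_fin.
move: (e / (L + 10)) d0 de => d d0 <-.
have : 0 <= l2 + d by lra.
lra.
Qed.
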